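(* Let $p$ be a prime and $n>1$ a natural number. Let $\mathcal{F}$ be a linear cellular automaton over the alphabet $(\mathbb{Z}/p\mathbb{Z})^n$ and let $A\in(\mathbb{Z}/p\mathbb{Z}[X,X^{-1}])^{n\times n}$ be the matrix associated with $\mathcal{F}$. Then $\mathcal{F}$ is positively expansive if and only if $A$ is expansive.
   Context: For a natural $m>1$, write $\mathbb{L}_m=\mathbb{Z}/m\mathbb{Z}[X,X^{-1}]$ (Laurent polynomials). A linear cellular automaton (LCA) over $(\mathbb{Z}/m\mathbb{Z})^n$ is a map $\mathcal{F}:((\mathbb{Z}/m\mathbb{Z})^n)^{\mathbb{Z}}\to((\mathbb{Z}/m\mathbb{Z})^n)^{\mathbb{Z}}$ given, for some radius $r\in\mathbb{N}$ and matrices $A_{-r},\dots,A_r\in(\mathbb{Z}/m\mathbb{Z})^{n\times n}$, by $\mathcal{F}(c)_i=\sum_{j=-r}^{r}A_j c_{i+j}$ for all $c$ and $i\in\mathbb{Z}$; its associated matrix is $A=\sum_{j=-r}^r A_jX^{-j}\in\mathbb{L}_m^{n\times n}$. The configuration space carries the metric $d(c,c')=2^{-\min\{|j|:c_j\neq c'_j\}}$ for $c\neq c'$ and $d(c,c)=0$. $\mathcal{F}$ is positively expansive if there is $\varepsilon>0$ such that for all configurations $c\neq c'$ there is $\ell\in\mathbb{N}$ with $d(\mathcal{F}^\ell(c),\mathcal{F}^\ell(c'))\geq\varepsilon$. For a nonzero $\alpha\in\mathbb{L}_m$, $\deg^+(\alpha)$ (resp. $\deg^-(\alpha)$) is the largest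 (resp. smallest) exponent of a monomial of $\alpha$ with nonzero coefficient; $\deg^+(0)=-\infty$, $\deg^-(0)=+\infty$. A monic polynomial $\pi(t)=\alpha_0+\alpha_1t+\dots+\alpha_{n-1}t^{n-1}+t^n\in\mathbb{L}_m[t]$ is expansive if $\alpha_0\neq0$ and (i) $\deg^+(\alpha_0)>0$ and $\deg^+(\alpha_0)>\deg^+(\alpha_i)$ for all $i\in\{1,\dots,n-1\}$, and (ii) $\deg^-(\alpha_0)<0$ and $\deg^-(\alpha_0)<\deg^-(\alpha_i)$ for all $i\in\{1,\dots,n-1\}$. A matrix $A\in\mathbb{L}_m^{n\times n}$ is expansive if its characteristic polynomial $\det(tI_n-A)$ is expansive. *)

(* Defs.v *)
From HB Require Import structures.
From Stdlib Require Import BinInt Rdefinitions Rpow_def ClassicalEpsilon ClassicalDescription.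
From mathcomp Require Import all_boot all_order all_algebra fraction.
Set Implicit Arguments. Unset Strict Implicit. Unset Printing Implicit Defensive.
Import Order.TTheory GRing.Theory Num.Theory.
Local Open Scope ring_scope.

Definition config (p n : nat) := int -> 'cV['F_p]_n.

Definition lca (p n r : nat) (Am : int -> 'M['F_p]_n) (c : config p n)
  : config p n :=
  fun i => \sum_(k < (2 * r).+1) Am (k%:Z - r%:Z) *m c (i + (k%:Z - r%:Z)).

Definition diff_at (p n : nat) (c c' : config p n) (k : nat) : bool :=
  (c k%:Z != c' k%:Z) || (c (- k%:Z) != c' (- k%:Z)).

Definition cdist (p n : nat) (c c' : config p n) : R :=
  match excluded_middle_informative (exists k, diff_at c c' k) with
  | left H => Rinv (pow (Rplus R1 R1) (ex_minn H))
  | right _ => R0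
  end.

Definition pos_expansive (p n : nat) (F : config p n -> config p n) : Prop :=
  exists eps : R, Rlt (R0) eps /\
    forall c c' : config p n, c <> c' ->
      exists l : nat, Rle eps (cdist (iter l F c) (iter l F c')).

(* L_p = F_p[X, X^-1] is realised inside the fraction field
   F_p(X) = {fraction {poly 'F_p}}, as the elements X^{-k} q, q a polynomial. *)
Local Notation "x %:F" := (@FracField.tofrac _ x).
Definition Lfrac (p : nat) := {fraction {poly 'F_p}}.

Definition Xl (p : nat) : Lfrac p := ('X : {poly 'F_p})%:F.

Definition lrep (p : nat) (x : Lfrac p) : nat * {poly 'F_p} :=
  epsilon (inhabits (0%N, 0))
    (fun kq : nat * {poly 'F_p} => x * Xl p ^+ kq.1 = (kq.2)%:F).

(* deg^+ : None stands for -oo (the value at 0). *)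
Definition deg_plus (p : nat) (x : Lfrac p) : option int :=
  if x == 0 then None
  else Some ((size (lrep x).2)%:Z - 1 - ((lrep x).1)%:Z).

(* deg^- : None stands for +oo (the value at 0). *)
Definition deg_minus (p : nat) (x : Lfrac p) : option int :=
  if x == 0 then None
  else Some ((find (fun a : 'F_p => a != 0) (lrep x).2)%:Z - ((lrep x).1)%:Z).

Definition lt_minf (a b : option int) : Prop :=
  match a, b with
  | None, Some _ => True
  | Some x, Some y => x < y
  | _, None => False
  end.

Definition lt_pinf (a b : option int) : Prop :=
  match a, b with
  | Some _, None => True
  | Some x, Some y => x < y
  | None, _ => False
  end.

Definition expansive_poly (p : nat) (pi : {poly Lfrac p}) : Prop :=
  let d := (size pi).-1 in
  [/\ pi \is monic, pi`_0 != 0,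
      (lt_minf (Some 0) (deg_plus pi`_0) /\
       forall i : nat, (0 < i < d)%N -> lt_minf (deg_plus pi`_i) (deg_plus pi`_0))
    & (lt_pinf (deg_minus pi`_0) (Some 0) /\
       forall i : nat, (0 < i < d)%N -> lt_pinf (deg_minus pi`_0) (deg_minus pi`_i))].

Definition assoc_mx (p n r : nat) (Am : int -> 'M['F_p]_n) : 'M[Lfrac p]_n :=
  \sum_(k < (2 * r).+1)
    (Xl p ^ (- (k%:Z - r%:Z))) *: map_mx (fun a : 'F_p => (a%:P)%:F) (Am (k%:Z - r%:Z)).

Definition mx_expansive (p n : nat) (A : 'M[Lfrac p]_n) : Prop :=
  expansive_poly (char_poly A).

(* Main.v *)
Require Import Defs.
From HB Require Import structures.
From Stdlib Require Import Reals Lra Classical ClassicalEpsilon FunctionalExtensionality.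
From mathcomp Require Import all_boot all_order all_algebra fraction generic_quotient.
From mathcomp Require Import zify ring.
Set Implicit Arguments. Unset Strict Implicit. Unset Printing Implicit Defensive.
Import Order.TTheory GRing.Theory Num.Theory.
Local Open Scope ring_scope.

(* Write A = X^(-r) P with P a polynomial matrix, and let nu be one of the two
   valuations deg^+ and -deg^- of F_p(X).

   If the characteristic polynomial of A is expansive, the Cayley-Hamilton
   identity, read at the extreme monomial of its constant coefficient, expresses
   the state of a site as a combination of later states of sites on one side of
   it and at bounded distance. A configuration whose orbit vanishes on a wide
   window therefore vanishes on the other side of the window, and the two
   valuations give the two sides.

   Conversely, if the automaton is positively expansive, compactness of the
   configuration space gives N such that nu (A^l v) <= d for all l <= N forces
   nu v <= d - 1, for every vector v over F_p(X). Hence det A <> 0 and the entries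
   of A^(-i) have negative valuation for large i. Take i = q a power of p: since
   (t - A)^q = t^q - A^q in characteristic p, the q-th power of the
   characteristic polynomial is det(A)^q det(t^q A^(-q) - 1), and the last
   factor is congruent to the constant (-1)^n modulo the maximal ideal of the
   valuation ring. So every other coefficient has smaller valuation than the
   constant one. *)

(** * Action of polynomials on bi-infinite sequences *)

Section PolyAction.
Variable K : comNzRingType.
Implicit Types (q u : {poly K}) (f g : int -> K) (s t : int).

(** Convolution: ['X] acts as the shift [f (s - 1)], which makes bi-infinite sequences a module over
    [{poly K}]. *)
Definition pact q f s : K := \sum_(i < size q) q`_i * f (s - i%:Z).

Lemma pact_widen N q f s : (size q <= N)%N ->
  pact q f s = \sum_(i < N) q`_i * f (s - i%:Z).
Proof.
move=> le_qN; rewrite /pact (big_ord_widen _ (fun i => q`_i * f (s - i%:Z)) le_qN).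
rewrite big_mkcond; apply: eq_bigr => i _; case: ltnP => // le_qi.
by rewrite nth_default ?mul0r.
Qed.

Lemma eq_pact q f g s : f =1 g -> pact q f s = pact q g s.
Proof. by move=> fg; apply: eq_bigr => i _; rewrite fg. Qed.

Lemma pact_shift q f t s : pact q (fun i => f (i + t)) s = pact q f (s + t).
Proof. by apply: eq_bigr => i _; rewrite addrAC. Qed.

Lemma pactDl q u f s : pact (q + u) f s = pact q f s + pact u f s.
Proof.
pose N := maxn (size q) (size u).
rewrite !(@pact_widen N) ?leq_maxl ?leq_maxr ?size_polyD //.
by rewrite -big_split; apply: eq_bigr => i _; rewrite coefD mulrDl.
Qed.

Lemma pact0l f s : pact 0 f s = 0.
Proof. by rewrite /pact size_poly0 big_ord0. Qed.

Lemma pact_suml I r (P : pred I) (F : I -> {poly K}) f s :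
  pact (\sum_(i <- r | P i) F i) f s = \sum_(i <- r | P i) pact (F i) f s.
Proof.
by apply: (big_morph (fun q => pact q f s)) => [q u|]; rewrite ?pactDl ?pact0l.
Qed.

Lemma pact_sumr I r (P : pred I) q (F : I -> int -> K) s :
  pact q (fun i => \sum_(j <- r | P j) F j i) s
    = \sum_(j <- r | P j) pact q (F j) s.
Proof.
rewrite /pact exchange_big; apply: eq_bigr => i _.
by rewrite mulr_sumr.
Qed.

Lemma pactBr q f g s : pact q (fun i => f i - g i) s = pact q f s - pact q g s.
Proof. by rewrite /pact -sumrB; apply: eq_bigr => i _; rewrite mulrBr. Qed.

Lemma pactCM a q f s : pact (a%:P * q) f s = a * pact q f s.
Proof.
rewrite (@pact_widen (size q)); last by rewrite mul_polyC size_scale_leq.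
by rewrite /pact mulr_sumr; apply: eq_bigr => i _; rewrite coefCM mulrA.
Qed.

Lemma pactC a f s : pact a%:P f s = a * f s.
Proof.
rewrite (@pact_widen 1) ?size_polyC_leq1 // big_ord1 coefC eqxx.
by rewrite subr0.
Qed.

Lemma pactMX q f s : pact (q * 'X) f s = pact q f (s - 1).
Proof.
rewrite (@pact_widen (size q).+1); last first.
  by rewrite (leq_trans (size_polyMleq _ _)) // size_polyX addn2.
rewrite big_ord_recl coefMX mul0r add0r; apply: eq_bigr => i _.
by rewrite coefMX /=; congr (_ * f _); rewrite /bump /= intS opprD addrA.
Qed.

Lemma pactMXn q k f s : pact (q * 'X^k) f s = pact q f (s - k%:Z).
Proof.
elim: k s => [|k IH] s; first by rewrite expr0 mulr1 subr0.
by rewrite exprSr mulrA pactMX IH intS opprD addrA.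
Qed.

Lemma pactM q u f s : pact (q * u) f s = pact q (pact u f) s.
Proof.
elim/poly_ind: q s => [|q a IH] s; first by rewrite mul0r !pact0l.
by rewrite mulrDl mulrAC !pactDl !pactMX IH pactCM pactC.
Qed.

(* Coefficients indexed by [int]: zero at the negative exponents. *)
Definition icoef q s : K := if s is Posz k then q`_k else 0.

(** Taking coefficients is acting on the Dirac sequence at [0], so the product of polynomials
    becomes a case of [pactM]. *)
Lemma icoefE q s : icoef q s = pact q (fun i => (i == 0)%:R) s.
Proof.
rewrite /pact; under eq_bigr => i _ do rewrite subr_eq0.
case: s => [k|k] /=; last first.
  by rewrite big1 // => i _; rewrite mulr0.
case: (ltnP k (size q)) => [lt_kq|le_qk].
  rewrite (bigD1 (Ordinal lt_kq)) //= eqxx mulr1 big1 ?addr0 // => i ne_ik.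
  by rewrite -val_eqE /= eq_sym in ne_ik; rewrite eqz_nat (negPf ne_ik) mulr0.
rewrite nth_default // big1 // => i _.
by rewrite eqz_nat gtn_eqF ?mulr0 // (leq_trans (ltn_ord i)).
Qed.

Lemma icoefM q u s : icoef (q * u) s = pact q (icoef u) s.
Proof. by rewrite icoefE pactM; apply: eq_pact => i; rewrite icoefE. Qed.

Lemma icoefD q u s : icoef (q + u) s = icoef q s + icoef u s.
Proof. by rewrite !icoefE pactDl. Qed.

Lemma icoef_sum I r (P : pred I) (F : I -> {poly K}) s :
  icoef (\sum_(i <- r | P i) F i) s = \sum_(i <- r | P i) icoef (F i) s.
Proof. by rewrite icoefE pact_suml; apply: eq_bigr => i _; rewrite icoefE. Qed.

End PolyAction.

(** * Action of polynomial matrices on configurations *)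

Section MatrixAction.
Variables (K : comNzRingType) (n : nat).
Implicit Types (M N : 'M[{poly K}]_n) (c : int -> 'cV[K]_n) (s t : int).

Definition mact M c s : 'cV[K]_n :=
  \col_a \sum_b pact (M a b) (fun i => c i b 0) s.

Lemma mactE M c s a : mact M c s a 0 = \sum_b pact (M a b) (fun i => c i b 0) s.
Proof. by rewrite mxE. Qed.

Lemma eq_mact M c c' s : c =1 c' -> mact M c s = mact M c' s.
Proof.
move=> cc; apply/colP => a; rewrite !mactE; apply: eq_bigr => b _.
by apply: eq_pact => i; rewrite cc.
Qed.

Lemma mact_shift M c t s : mact M (fun i => c (i + t)) s = mact M c (s + t).
Proof.
apply/colP => a; rewrite !mactE; apply: eq_bigr => b _.
exact: (pact_shift _ (fun i => c i b 0)).
Qed.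

Lemma mactB M c c' s : mact M (fun i => c i - c' i) s = mact M c s - mact M c' s.
Proof.
apply/colP => a; rewrite !mxE -sumrB; apply: eq_bigr => b _.
by rewrite -pactBr; apply: eq_pact => i; rewrite !mxE.
Qed.

Lemma mactM M N c s : mact (M *m N) c s = mact M (mact N c) s.
Proof.
apply/colP => a; rewrite !mactE.
under eq_bigr => b _ do
  rewrite mxE pact_suml; rewrite exchange_big; apply: eq_bigr => b _ /=.
under eq_bigr => d _ do rewrite pactM.
rewrite -pact_sumr; apply: eq_pact => i; by rewrite mactE.
Qed.

Lemma mact1 c s : mact 1%:M c s = c s.
Proof.
apply/colP => a; rewrite mactE (bigD1 a) //= mxE eqxx mulr1n pactC mul1r.
rewrite big1 ?addr0 // => b ne_ba; rewrite mxE eq_sym (negPf ne_ba) mulr0n.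
exact: pact0l.
Qed.

Lemma mactZ q M c s a :
  mact (q *: M) c s a 0 = pact q (fun i => mact M c i a 0) s.
Proof.
rewrite mactE (@eq_pact _ q _ (fun i => \sum_b pact (M a b) (fun j => c j b 0) i)); last first.
  by move=> i; rewrite mactE.
by rewrite pact_sumr; apply: eq_bigr => b _; rewrite mxE pactM.
Qed.

Lemma mact_sum I r (P : pred I) (F : I -> 'M[{poly K}]_n) c s :
  mact (\sum_(i <- r | P i) F i) c s = \sum_(i <- r | P i) mact (F i) c s.
Proof.
apply/colP => a; rewrite mactE summxE.
under [RHS]eq_bigr => i _ do rewrite mactE.
rewrite exchange_big; apply: eq_bigr => b _; by rewrite summxE pact_suml.
Qed.

Lemma mact0l c s : mact 0 c s = 0.
Proof.
apply/colP => a; rewrite mactE mxE big1 // => b _; by rewrite mxE pact0l.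
Qed.

Definition vcoef (v : 'cV[{poly K}]_n) s : 'cV[K]_n := \col_b icoef (v b 0) s.

(** Identifies polynomial vectors with configurations of finite support, on which matrix
    multiplication is the action [mact]. *)
Lemma vcoefM M v s : vcoef (M *m v) s = mact M (vcoef v) s.
Proof.
apply/colP => a; rewrite !mxE icoef_sum; apply: eq_bigr => b _.
by rewrite icoefM; apply: eq_pact => i; rewrite mxE.
Qed.

End MatrixAction.

(** * Degrees and valuations *)

(** [true] stands for [deg^+] and the right side, [false] for [- deg^-] and the left, so that both
    sides are treated at once. *)
Definition dirz (b : bool) : int := if b then 1 else -1.

Lemma dirzK b s : dirz b * (dirz b * s) = s.
Proof. by case: b; rewrite /dirz ?mul1r // mulN1r mulN1r opprK. Qed.

Section Degree.
Variable (K : fieldType) (b : bool).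
Implicit Types (q u : {poly K}) (d s : int).
Local Notation sg := (dirz b).

(* [deg^+] for [b = true] and [- deg^-] for [b = false]; the value at [0] is
   junk. *)
Definition pdeg q : int :=
  if b then (size q)%:Z - 1 else - (find (fun a : K => a != 0) q)%:Z.

Lemma icoef_pdeg q : q != 0 -> icoef q (sg * pdeg q) != 0.
Proof.
move=> q0; rewrite /pdeg /dirz; case: b; last first.
  rewrite mulN1r opprK /=.
  apply: (@nth_find _ 0 (fun a : K => a != 0) q).
  apply/hasP; exists (lead_coef q); last by rewrite lead_coef_eq0.
  by rewrite mem_nth // prednK // size_poly_gt0.
rewrite mul1r; have : (0 < size q)%N by rewrite size_poly_gt0.
case E: (size q) => [//|m] _; rewrite intS addrAC subrr add0r /=.
by move: q0; rewrite -lead_coef_eq0 /lead_coef E.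
Qed.

Lemma icoef_gt_pdeg q s : pdeg q < sg * s -> icoef q s = 0.
Proof.
case: s => [k|//] /=; rewrite /pdeg /dirz; case: b => lt_qs.
  by rewrite nth_default //; move: lt_qs; rewrite mul1r ltrBlDr -PoszD ltz_nat addn1 ltnS.
rewrite mulN1r ltrN2 ltz_nat in lt_qs.
apply/eqP/negPn/negP => qk.
have := @before_find _ 0 (fun a : K => a != 0) q k.
by rewrite qk => H; have : true = false; [exact: H|].
Qed.

Lemma pdeg_le q d : q != 0 ->
  (pdeg q <= d) <-> (forall s, d < sg * s -> icoef q s = 0).
Proof.
move=> q0; split=> [le_qd s lt_ds|H].
  by apply: icoef_gt_pdeg; apply: le_lt_trans lt_ds.
rewrite leNgt; apply/negP => lt_dq; move/eqP: (icoef_pdeg q0); apply.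
by apply: H; rewrite dirzK.
Qed.

Lemma pdegM q u : q != 0 -> u != 0 -> pdeg (q * u) = pdeg q + pdeg u.
Proof.
move=> q0 u0; have qu0 : q * u != 0 by rewrite mulf_neq0.
apply/eqP; rewrite eq_le; apply/andP; split.
  apply/(pdeg_le _ qu0) => s lt_s; rewrite icoefM /pact big1 // => i _.
  case: (ltP (pdeg q) (sg * i%:Z)) => [/icoef_gt_pdeg /= ->|le_iq].
    by rewrite mul0r.
  by rewrite [icoef u _]icoef_gt_pdeg ?mulr0 // mulrBr; lia.
rewrite leNgt; apply/negP => lt_qu.
have : icoef (q * u) (sg * (pdeg q + pdeg u)) = 0.
  by apply: icoef_gt_pdeg; rewrite dirzK.
rewrite icoefM /pact.
have := icoef_pdeg q0; case E: (sg * pdeg q) => [k|k] /=; last by rewrite eqxx.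
move=> qk; have lt_kq : (k < size q)%N.
  by rewrite ltnNge; apply/negP => le_qk; rewrite nth_default ?eqxx in qk.
(* Only the product of the two extreme coefficients survives: at any other index one factor lies
   beyond its extreme exponent. *)
rewrite (bigD1 (Ordinal lt_kq)) //= big1 ?addr0 => [|i ne_ik].
  apply/eqP; rewrite mulf_neq0 // mulrDr E addrAC subrr add0r.
  exact: icoef_pdeg.
have ik : (i : nat) != k by rewrite -val_eqE in ne_ik.
have [lt_qi|le_iq] := ltP (pdeg q) (sg * i%:Z).
  by have /= -> := icoef_gt_pdeg lt_qi; rewrite mul0r.
rewrite [icoef u _]icoef_gt_pdeg ?mulr0 //.
have ne_iq : sg * i%:Z != pdeg q.
  by apply: contraNneq ik => iq; rewrite -eqz_nat -E -iq dirzK.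
by rewrite mulrBr dirzK [pdeg q + _]addrC -addrA ltrDl subr_gt0 lt_neqAle ne_iq.
Qed.

Lemma pdegD q u d : q != 0 -> u != 0 -> q + u != 0 ->
  pdeg q <= d -> pdeg u <= d -> pdeg (q + u) <= d.
Proof.
move=> q0 u0 qu0 /(pdeg_le _ q0) hq /(pdeg_le _ u0) hu.
by apply/(pdeg_le _ qu0) => s lt_s; rewrite icoefD hq // hu // addr0.
Qed.

Lemma pdegC a : a != 0 -> pdeg a%:P = 0.
Proof.
move=> a0; rewrite /pdeg size_polyC polyseqC a0 /=; case: b; rewrite ?subrr //.
by rewrite a0 oppr0.
Qed.

Lemma pdegX : pdeg 'X = sg.
Proof.
rewrite /pdeg size_polyX polyseqX /dirz; case: b => //=.
by rewrite eqxx /= oner_eq0.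
Qed.

End Degree.


(* In degree convention (the order is reversed with respect to the usual one);
   the value at [0] is unconstrained. *)
Definition valuation (E : fieldType) (nu : E -> int) : Prop :=
  (forall x y, x != 0 -> y != 0 -> nu (x * y) = nu x + nu y) /\
  (forall x y d, x != 0 -> y != 0 -> x + y != 0 ->
     nu x <= d -> nu y <= d -> nu (x + y) <= d).

(** Puts [0] below every bound, whatever the junk value [nu 0]. *)
Definition vle (E : fieldType) (nu : E -> int) (x : E) (d : int) : bool :=
  (x == 0) || (nu x <= d).

Section Valuation.
Variables (E : fieldType) (nu : E -> int).
Hypothesis nuP : valuation nu.
Implicit Types (x y : E) (d e : int).

Lemma nuM x y : x != 0 -> y != 0 -> nu (x * y) = nu x + nu y.
Proof. by case: nuP => h _; apply: h. Qed.

Lemma nu1 : nu 1 = 0.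
Proof.
have /eqP := nuM (oner_neq0 E) (oner_neq0 E).
by rewrite mul1r -subr_eq0 opprD addrA subrr sub0r oppr_eq0 => /eqP.
Qed.

Lemma nuX x k : x != 0 -> nu (x ^+ k) = nu x *+ k.
Proof.
move=> x0; elim: k => [|k IH]; first by rewrite expr0 nu1.
by rewrite exprS nuM ?expf_neq0 // IH mulrS.
Qed.

Lemma vle0 d : vle nu 0 d. Proof. by rewrite /vle eqxx. Qed.

Lemma vle_neq0 x d : x != 0 -> vle nu x d = (nu x <= d).
Proof. by rewrite /vle => /negPf->. Qed.

Lemma nu_vle x : vle nu x (nu x).
Proof. by rewrite /vle lexx orbT. Qed.

Lemma vleW x d e : d <= e -> vle nu x d -> vle nu x e.
Proof.
have [-> _ _|x0 de] := eqVneq x 0; first exact: vle0.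
by rewrite !vle_neq0 // => xd; apply: le_trans de.
Qed.

Lemma vleM x y d e : vle nu x d -> vle nu y e -> vle nu (x * y) (d + e).
Proof.
have [->|x0] := eqVneq x 0; first by move=> _ _; rewrite mul0r vle0.
have [->|y0] := eqVneq y 0; first by move=> _ _; rewrite mulr0 vle0.
by rewrite !vle_neq0 ?mulf_neq0 // nuM //; apply: lerD.
Qed.

Lemma vleM_eq x y d : y != 0 -> vle nu (x * y) (d + nu y) = vle nu x d.
Proof.
move=> y0; have [->|x0] := eqVneq x 0; first by rewrite mul0r !vle0.
by rewrite !vle_neq0 ?mulf_neq0 // nuM // lerD2r.
Qed.

Lemma vleD x y d : vle nu x d -> vle nu y d -> vle nu (x + y) d.
Proof.
have [->|x0] := eqVneq x 0; first by rewrite add0r.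
have [->|y0] := eqVneq y 0; first by rewrite addr0.
have [->|xy0] := eqVneq (x + y) 0; first by rewrite vle0.
by rewrite !vle_neq0 //; case: nuP => _; apply.
Qed.

Lemma nuN1 : nu (-1) = 0.
Proof.
have n0 : -1 != 0 :> E by rewrite oppr_eq0 oner_eq0.
by have := nuX 2 n0; rewrite sqrrN expr1n nu1 mulr2n; lia.
Qed.

Lemma vleN x d : vle nu (- x) d = vle nu x d.
Proof.
have n0 : -1 != 0 :> E by rewrite oppr_eq0 oner_eq0.
by rewrite -mulrN1 -[in LHS](addr0 d) -nuN1 vleM_eq.
Qed.

Lemma vle_sum I r (P : pred I) (F : I -> E) d :
  (forall i, P i -> vle nu (F i) d) -> vle nu (\sum_(i <- r | P i) F i) d.
Proof.
by move=> h; apply: (big_ind (fun x => vle nu x d)) => [|x y|] //; [exact: vle0 | exact: vleD].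
Qed.

Lemma vle_all x : (forall d, vle nu x d) -> x = 0.
Proof.
move=> /(_ (nu x - 1)); have [//|x0] := eqVneq x 0.
by rewrite vle_neq0 // lerBrDr gerDl.
Qed.

End Valuation.

(** * The two degree valuations of the fraction field *)

Local Notation "x %:F" := (@FracField.tofrac _ x).

Section FractionDegree.
Variable (K : fieldType) (b : bool).
Local Notation E := {fraction {poly K}}.
Implicit Types (x y : E) (d e : int).

Lemma frac_reprE x : x = (\n_(repr x))%:F / (\d_(repr x))%:F.
Proof.
have dx : (\d_(repr x))%:F != 0 :> E by rewrite tofrac_eq0 ?denom_ratioP.
apply: (mulIf dx); rewrite divfK //.
suff H (y : {ratio {poly K}}) : \pi_E%qT y * (\d_y)%:F = (\n_y)%:F.
  by rewrite -{1}[x]reprK H.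
rewrite [LHS]piE piE; apply/eqP.
rewrite piE.
have y0 : \d_y != 0 by exact: denom_ratioP.
have y10 : \d_y * 1 != 0 by rewrite mulr1.
rewrite FracField.equivfE /FracField.mulf !(numer_Ratio,denom_Ratio) ?oner_neq0 //.
by rewrite !mulr1 mulrC.
Qed.

Definition nu x : int := pdeg b (\n_(repr x)) - pdeg b (\d_(repr x)).

(** Cross-multiplication and [pdegM] make the difference of degrees independent of the chosen
    fraction. *)
Lemma nu_frac (u q : {poly K}) : u != 0 -> q != 0 ->
  nu (u%:F / q%:F) = pdeg b u - pdeg b q.
Proof.
move=> u0 q0; have [x Ex] : exists x : E, x = u%:F / q%:F by exists (u%:F / q%:F).
rewrite -Ex /nu; move: (frac_reprE x) (denom_ratioP (repr x)).
move: (\n_(repr x)) (\d_(repr x)) => m e; rewrite {x}Ex => /eqP + e0.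
rewrite eqr_div ?tofrac_eq0 // -!tofracM tofrac_eq => /eqP ue.
have m0 : m != 0.
  by apply: contraNneq u0 => m0; move/eqP: ue; rewrite m0 mul0r mulf_eq0 (negPf e0) orbF.
have := pdegM b u0 e0; rewrite ue pdegM //; lia.
Qed.

Lemma frac_ex x : exists u q : {poly K}, q != 0 /\ x = u%:F / q%:F.
Proof. by exists (\n_(repr x)), (\d_(repr x)); rewrite -frac_reprE denom_ratioP. Qed.

Lemma frac_neq0 (u q : {poly K}) : u%:F / q%:F != 0 :> E -> u != 0.
Proof. by apply: contraNneq => ->; rewrite tofrac0 mul0r. Qed.

Lemma nu_tofrac (u : {poly K}) : u != 0 -> nu u%:F = pdeg b u.
Proof.
move=> u0; rewrite -[u%:F]divr1 -tofrac1 nu_frac ?oner_eq0 //.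
by rewrite (pdegC b (oner_neq0 K)) subr0.
Qed.

Lemma nu_valuation : valuation nu.
Proof.
split=> [x y|x y d].
  have [u [q [q0 ->]]] := frac_ex x; have [v [w [w0 ->]]] := frac_ex y.
  move=> /frac_neq0 u0 /frac_neq0 v0.
  rewrite mulf_div -!tofracM !nu_frac ?mulf_neq0 // !pdegM //; lia.
have [u [q [q0 ->]]] := frac_ex x; have [v [w [w0 ->]]] := frac_ex y.
have q0F : q%:F != 0 :> E by rewrite tofrac_eq0.
have w0F : w%:F != 0 :> E by rewrite tofrac_eq0.
move=> /frac_neq0 u0 /frac_neq0 v0.
rewrite (addf_div _ _ q0F w0F) -!tofracM -tofracD => /frac_neq0 s0.
rewrite !nu_frac ?mulf_neq0 // => hu hv.
rewrite lerBlDr; apply: pdegD; rewrite ?mulf_neq0 // !pdegM //; lia.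
Qed.

(** Bridge between valuation bounds and the vanishing of sites of a configuration. *)
Lemma vle_tofrac (u : {poly K}) d :
  vle nu u%:F d <-> (forall s, d < dirz b * s -> icoef u s = 0).
Proof.
rewrite /vle tofrac_eq0; have [->|u0] := eqVneq u 0; last first.
  by rewrite nu_tofrac //=; apply: pdeg_le.
by split=> // _ [s|s] _ //=; rewrite coef0.
Qed.

Lemma frac_common_denom (n : nat) (v : 'cV[E]_n) :
  exists (q : {poly K}) (w : 'cV[{poly K}]_n),
    q != 0 /\ map_mx (@FracField.tofrac _) w = q%:F *: v.
Proof.
pose q := \prod_i \d_(repr (v i 0)).
have q0 : q != 0 by apply/prodf_neq0 => i _; exact: denom_ratioP.
exists q, (\col_i (\n_(repr (v i 0)) * \prod_(j | j != i) \d_(repr (v j 0)))).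
split=> //; apply/colP => i; rewrite !mxE.
have -> : q = \d_(repr (v i 0)) * \prod_(j | j != i) \d_(repr (v j 0)).
  by rewrite /q (bigD1 i).
move: (\prod_(j | j != i) _) (frac_reprE (v i 0)) (denom_ratioP (repr (v i 0))).
move: (\n_(repr (v i 0))) (\d_(repr (v i 0))) => m e t Ev e0.
by rewrite {}Ev !tofracM [RHS]mulrC mulrA divfK ?tofrac_eq0.
Qed.

End FractionDegree.

(** * Characteristic polynomials and powers of the inverse matrix *)

Lemma exprB_comm_pchar (R : nzRingType) (p k : nat) (x y : R) :
  p \in [pchar R] -> GRing.comm x y ->
  (x - y) ^+ (p ^ k) = x ^+ (p ^ k) - y ^+ (p ^ k).
Proof.
move=> chp cxy; elim: k => [|k IH]; first by rewrite !expr1.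
rewrite expnSr !exprM IH -!(pFrobenius_autE chp) pFrobenius_autB_comm //.
by apply: commrX; apply: commr_sym; apply: commrX; apply: commr_sym.
Qed.

(** The Frobenius map is additive, so raising to the power [p] acts on each monomial separately;
    iterate [k] times. *)
Lemma coef_exp_pchar (R : comNzRingType) (p k i : nat) (f : {poly R}) :
  p \in [pchar R] -> (f ^+ (p ^ k))`_(i * p ^ k) = f`_i ^+ (p ^ k).
Proof.
move=> chp; have p_gt0 : (0 < p)%N by rewrite prime_gt0 // (pcharf_prime chp).
have chpP : p \in [pchar {poly R}] by rewrite pchar_poly.
have step (g : {poly R}) j : (g ^+ p)`_(j * p) = g`_j ^+ p.
  rewrite -{1}[g]coefK poly_def -(pFrobenius_autE chpP) rmorph_sum coef_sum /=.
  under eq_bigr => m _ do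
    rewrite pFrobenius_autE exprZn -exprM coefZ coefXn eqn_pmul2r //.
  have [lt_jg|le_gj] := ltnP j (size g).
    rewrite (bigD1 (Ordinal lt_jg)) //= eqxx mulr1 big1 ?addr0 // => m.
    by rewrite -val_eqE /= eq_sym => /negPf ->; rewrite mulr0.
  rewrite [g`_j]nth_default // expr0n eqn0Ngt p_gt0 big1 // => m _.
  by rewrite gtn_eqF ?mulr0 // (leq_trans (ltn_ord m)).
elim: k i => [|k IH] i; first by rewrite muln1.
by rewrite expnSr mulnA exprM step IH -exprM.
Qed.

Lemma det_expr (R : comNzRingType) n (M : 'M[R]_n.+1) k :
  \det (M ^+ k) = \det M ^+ k.
Proof.
elim: k => [|k IH]; first by rewrite !expr0 det1.
by rewrite !exprS -IH -det_mulmx.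
Qed.

Section Congruence.
Variables (E : fieldType) (nu : E -> int).
Hypothesis nuP : valuation nu.
Implicit Types f g : {poly E}.

Let coefs_le d f := forall i, vle nu f`_i d.

(* [f] and [g] have coefficients in the valuation ring and agree modulo its
   maximal ideal. *)
Let cong f g := [/\ coefs_le 0 f, coefs_le 0 g & coefs_le (-1) (f - g)].

Let coefs_leM d e f g : coefs_le d f -> coefs_le e g -> coefs_le (d + e) (f * g).
Proof. by move=> hf hg i; rewrite coefM; apply: vle_sum => // j _; apply: vleM. Qed.

Let coefs_leD d f g : coefs_le d f -> coefs_le d g -> coefs_le d (f + g).
Proof. by move=> hf hg i; rewrite coefD; apply: vleD. Qed.

Let coefs_leC a d : vle nu a d -> coefs_le d a%:P.
Proof. by move=> ha i; rewrite coefC; case: eqP => // _; apply: vle0. Qed.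

Let cong_refl f : coefs_le 0 f -> cong f f.
Proof. by move=> hf; split=> // i; rewrite subrr coef0; apply: vle0. Qed.

Let cong1 : cong 1 1.
Proof. by apply: cong_refl; apply: coefs_leC; rewrite -(nu1 nuP); apply: nu_vle. Qed.

Let congM f f' g g' : cong f f' -> cong g g' -> cong (f * g) (f' * g').
Proof.
case=> hf hf' hff' [hg hg' hgg']; split.
- by rewrite -[0]addr0; apply: coefs_leM.
- by rewrite -[0]addr0; apply: coefs_leM.
have -> : f * g - f' * g' = f * (g - g') + (f - f') * g' by ring.
by apply: coefs_leD; [rewrite -[-1]add0r|rewrite -[-1]addr0]; apply: coefs_leM.
Qed.

Let congD f f' g g' : cong f f' -> cong g g' -> cong (f + g) (f' + g').
Proof.
case=> hf hf' hff' [hg hg' hgg']; split; do ?exact: coefs_leD.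
by rewrite opprD addrACA; apply: coefs_leD.
Qed.

Let congN1 k : cong ((-1) ^+ k) ((-1) ^+ k).
Proof.
elim: k => [|k IH]; first exact: cong1.
rewrite exprS; apply: congM IH; apply: cong_refl; rewrite -polyCN.
by apply: coefs_leC; rewrite vleN // -(nu1 nuP); apply: nu_vle.
Qed.

Let cong_det n (M N : 'M[{poly E}]_n) :
  (forall i j, cong (M i j) (N i j)) -> cong (\det M) (\det N).
Proof.
move=> hMN; rewrite /determinant; apply: (big_ind2 cong) => [||s _].
- by apply: cong_refl => i; rewrite coef0; apply: vle0.
- by move=> f f' g g'; apply: congD.
by apply: congM; [exact: congN1 | apply: (big_ind2 cong) => // *; exact: congM].
Qed.

(** With [q = p ^ k], the two expressions of the [q]-th power of [char_poly A] are compared in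
    degree [i * q], where the power contributes the [q]-th power of the [i]-th coefficient. *)
Lemma char_poly_coef_lt n (A : 'M[E]_n.+1) (p k : nat) :
  p \in [pchar E] -> \det A != 0 ->
  (forall i j, vle nu ((A^-1 ^+ (p ^ k)) i j) (-1)) ->
  (char_poly A)`_0 != 0 /\
  (forall i, (0 < i)%N -> vle nu (char_poly A)`_i (nu (char_poly A)`_0 - 1)).
Proof.
move=> chp dA0 hB; set q := (p ^ k)%N; set B := A^-1 ^+ q in hB.
have uA : A \is a GRing.unit by rewrite -[_ \is a _]/(A \in unitmx) unitmxE unitfE.
have q_gt0 : (0 < q)%N by rewrite expn_gt0 prime_gt0 // (pcharf_prime chp).
have s0 m : (-1) ^+ m != 0 :> E by rewrite expf_neq0 // oppr_eq0 oner_eq0.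
have a0E : (char_poly A)`_0 = (-1) ^+ n.+1 * \det A by rewrite char_poly_det.
have a00 : (char_poly A)`_0 != 0 by rewrite a0E mulf_neq0.
have nuA : nu (char_poly A)`_0 = nu (\det A).
  rewrite a0E nuM // nuX ?oppr_eq0 ?oner_eq0 // nuN1 // mul0rn add0r //.
split=> // i i_gt0; rewrite nuA.
pose g := \det ('X^q *: map_mx polyC B - 1%:M).
have chg : char_poly A ^+ q = (\det A ^+ q)%:P * g.
  have chM : p \in [pchar 'M[{poly E}]_n.+1].
    apply: (rmorph_pchar (@scalar_mx _ n.+1)).
    by rewrite pchar_poly.
  rewrite /char_poly /char_poly_mx -det_expr.
  rewrite (exprB_comm_pchar k chM); last exact: comm_scalar_mx.
  have <- : \det (map_mx polyC (A ^+ q)) = (\det A ^+ q)%:P.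
    by rewrite det_map_mx det_expr.
  rewrite -det_mulmx mulmxBr mulmx1 -scalemxAr -map_mxM.
  have -> : A ^+ q *m B = 1.
    rewrite -[_ *m _]/(_ * _) /B -exprMn_comm ?divrr ?expr1n //.
    exact: commrV.
  have EA : map_mx polyC (A ^+ q) = (map_mx polyC A : 'M_n.+1) ^+ q.
    exact: rmorphXn.
  have EX : ('X%:M : 'M[{poly E}]_n.+1) ^+ q = ('X^q)%:M.
    by rewrite -rmorphXn.
  by rewrite EX EA map_mx1 scalemx1.
(* Modulo the maximal ideal [B] vanishes and [g] is a constant, which has no coefficient in degree
   [i * q > 0]. *)
have hg : vle nu g`_(i * q) (-1).
  have [_ _ /(_ (i * q)%N)] : cong g (\det (- 1%:M : 'M[{poly E}]_n.+1)).
    apply: cong_det => a b; rewrite !mxE.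
    have h1 : cong (- (a == b)%:R) (- (a == b)%:R).
      case: (a == b); last by rewrite oppr0; apply: cong_refl => m; rewrite coef0; apply: vle0.
      exact: (congN1 1).
    case: (h1) => h _ _.
    have hX : coefs_le (-1) ('X^q * (B a b)%:P).
      by move=> m; rewrite coefXnM; case: ifP => _; [apply: vle0|apply: coefs_leC].
    split=> //; last by rewrite addrK.
    by apply: coefs_leD => // m; apply: vleW (hX m).
  rewrite -[- 1%:M](raddfN (@scalar_mx _ n.+1)) det_scalar coefB.
  rewrite -polyCN -rmorphXn coefC muln_eq0.
  by rewrite eqn0Ngt i_gt0 eqn0Ngt q_gt0 subr0.
have := coef_exp_pchar k i (char_poly A) chp; rewrite -/q chg coefCM => ai.
have [->|ai0] := eqVneq (char_poly A)`_i 0; first exact: vle0.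
rewrite vle_neq0 //.
have : vle nu ((char_poly A)`_i ^+ q) (nu (\det A) *+ q - 1).
  by rewrite -ai -nuX //; apply: vleM => //; apply: nu_vle.
(* Valuations are integers: [q * u <= q * v - 1] with [q > 0] gives [u <= v - 1]. *)
by rewrite vle_neq0 ?expf_neq0 // nuX // !lerBrDr !lezD1 ltrMn2r q_gt0.
Qed.

End Congruence.

(** * Koenig's lemma over a finite alphabet *)

Section Koenig.
Variables (T : finType) (f : nat -> nat -> T).

Let frequent (s : seq T) :=
  forall N0, exists2 N, (N0 <= N)%N & mkseq (f N) (size s) = s.

(** Pigeonhole: if each letter [x] ceased to extend [s] from some rank on, the maximum of these
    finitely many ranks would contradict the frequency of [s]. *)
Let frequent_rcons s : frequent s -> exists x, frequent (rcons s x).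
Proof.
move=> fs; apply: NNPP => nofreq.
have bad x : exists N0, forall N, (N0 <= N)%N ->
    mkseq (f N) (size s).+1 <> rcons s x.
  apply: NNPP => nb; apply: nofreq; exists x => N0; apply: NNPP => nN.
  apply: nb; exists N0 => N leN E; apply: nN; exists N => //.
  by rewrite size_rcons.
have [N0 hN0] := fin_all_exists bad.
have [N leN E] := fs (\max_x N0 x)%N.
apply: (hN0 (f N (size s)) N); last by rewrite mkseqS E.
exact: leq_trans (leq_bigmax _) leN.
Qed.

(** [g] is a limit point of the sequence [f] in the product topology, obtained by extending a
    frequent prefix one letter at a time. *)
Lemma koenig : exists g : nat -> T, forall M N0,
  exists2 N, (N0 <= N)%N & forall j, (j < M)%N -> f N j = g j.
Proof.
pose ch s := epsilon (inhabits (f 0%N 0%N)) (fun x => frequent (rcons s x)).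
pose sq n := iter n (fun s => rcons s (ch s)) [::].
have freq_sq n : frequent (sq n).
  elim: n => [|n IH]; first by move=> N0; exists N0.
  exact: (epsilon_spec _ _ (frequent_rcons IH)).
pose g n := ch (sq n).
have sqE n : sq n = mkseq g n.
  by elim: n => [//|n IH]; rewrite mkseqS -IH.
exists g => M N0; have [N leN] := freq_sq M N0; rewrite sqE size_mkseq => E.
exists N => // j ltjM; have := congr1 (fun s => nth (g j) s j) E.
by rewrite !nth_mkseq.
Qed.

End Koenig.

(** * Expanding matrices over a valued field *)

Section Descent.
Variables (E : fieldType) (nu : E -> int).
Hypothesis nuP : valuation nu.
Variables (n : nat) (A : 'M[E]_n.+1).

Definition mxle (m k : nat) (M : 'M[E]_(m, k)) (d : int) :=
  forall a b, vle nu (M a b) d.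

Lemma mxle_bound m k (M : 'M[E]_(m, k)) : exists d : nat, mxle M d%:Z.
Proof.
exists (\max_ab `|nu (M ab.1 ab.2)|)%N => a b.
apply: (@vleW _ _ _ (nu (M a b))); last exact: nu_vle.
apply: le_trans (ler_norm _) _; rewrite -abszE lez_nat.
exact: (leq_bigmax (a, b)).
Qed.

Lemma mxleW m k (M : 'M[E]_(m, k)) d e : d <= e -> mxle M d -> mxle M e.
Proof. by move=> de hM a b; apply: vleW (hM a b). Qed.

Variable N : nat.
Hypothesis expA : forall (v : 'cV[E]_n.+1) d,
  (forall l, (l <= N)%N -> mxle (A ^+ l *m v) d) -> mxle v (d - 1).

(** On a kernel vector only [l = 0] constrains in [expA], so any bound can be lowered by one
    indefinitely and the vector is zero. *)
Lemma expanding_det_neq0 : \det A != 0.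
Proof.
apply/negP; rewrite -det_tr => /det0P[v v0 vA].
have Av : A *m v^T = 0 by rewrite -[A]trmxK -trmx_mul vA trmx0.
have [d hd] := mxle_bound v^T.
suff hv (k : nat) : mxle v^T (d%:Z - k%:Z).
  case/negP: v0; apply/eqP/rowP => b; rewrite [RHS]mxE.
  apply: (vle_all (nu := nu)) => e.
  have := hv `|d%:Z - e|%N b 0; rewrite mxE; apply: vleW.
  by rewrite lerBlDl -lerBlDr abszE ler_norm.
elim: k => [|k IH]; first by rewrite subr0.
rewrite -[k.+1]addn1 PoszD opprD addrA; apply: expA => -[_|l _].
  by rewrite mul1mx.
rewrite exprSr -[A ^+ l * A]/(A ^+ l *m A) -mulmxA Av mulmx0 => a b.
by rewrite mxE; apply: vle0.
Qed.

Lemma expanding_inverse_powers : exists m, forall i, (m <= i)%N ->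
  mxle (A^-1 ^+ i) (-1).
Proof.
set B := A^-1.
have uA : A \is a GRing.unit.
  by rewrite -[_ \is a _]/(A \in unitmx) unitmxE unitfE expanding_det_neq0.
have AB l i : (l <= i)%N -> A ^+ l * B ^+ i = B ^+ (i - l).
  move=> le_li; rewrite -{1}(subnKC le_li) exprD mulrA -exprMn_comm.
    by rewrite divrr // expr1n mul1r.
  exact: commrV.
have expM k (M : 'M[E]_(n.+1, k)) d :
    (forall l, (l <= N)%N -> mxle (A ^+ l *m M) d) -> mxle M (d - 1).
  move=> hM a b; have := expA (v := col b M) (d := d).
  move=> /(_ _ a 0); rewrite mxE; apply=> l le_lN c j.
  by rewrite colE mulmxA -colE mxE; apply: hM.
have step i d : (N <= i)%N ->
    (forall l, (0 < l <= N)%N -> mxle (B ^+ (i - l)) d) -> mxle (B ^+ i) (d - 1).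
  move=> le_Ni hB.
  (* The case [l = 0] of [expA] involves [B ^+ i] itself, so an arbitrary initial bound is first
     lowered to [d] one unit at a time, then once more. *)
  have improve e : d <= e -> mxle (B ^+ i) e -> mxle (B ^+ i) (e - 1).
    move=> de he; apply: expM => -[_|l lt_lN]; first by rewrite mul1mx.
    rewrite -[_ *m _]/(_ * _) AB; last exact: leq_trans le_Ni.
    by apply: mxleW de _; apply: hB.
  apply: (improve _ (lexx d)).
  suff down (k : nat) : mxle (B ^+ i) (d + k%:Z) -> mxle (B ^+ i) d.
    have [e he] := mxle_bound (B ^+ i).
    apply: (down `|e%:Z - d|%N); apply: mxleW he.
    by rewrite -lerBlDl abszE ler_norm.
  elim: k => [|k IH]; first by rewrite addr0.
  move=> hk; apply: IH; have := improve _ _ hk.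
  by rewrite -[k.+1]addn1 PoszD addrA addrK; apply; rewrite -addrA lerDl.
have [d hd] : exists d : nat, forall i, (i < N)%N -> mxle (B ^+ i) d%:Z.
  have [F hF] := fin_all_exists (fun i : 'I_N => mxle_bound (B ^+ i)).
  exists (\max_i F i)%N => i lt_iN.
  by apply: mxleW (hF (Ordinal lt_iN)); rewrite lez_nat leq_bigmax.
(* The bound drops by one each time the exponent grows by [N]; for [j = 0] it is propagated from the
   first [N] powers. *)
have main (j : nat) : forall i, (j * N <= i)%N -> mxle (B ^+ i) (d%:Z - j%:Z).
  elim: j => [|j IH] i le_i.
    rewrite subr0; elim/ltn_ind: i {le_i} => i IHi.
    have [lt_iN|le_Ni] := ltnP i N; first exact: hd.
    apply: (@mxleW _ _ _ (d%:Z - 1)); first by rewrite gerBl.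
    apply: step => // l /andP[l0 lN]; apply: IHi.
    by rewrite ltn_subrL l0 (leq_trans _ le_Ni) // (leq_trans l0).
  rewrite -[j.+1]addn1 PoszD opprD addrA; apply: step => [|l /andP[_ lN]].
    by apply: leq_trans le_i; rewrite mulSn leq_addr.
  by apply: IH; rewrite leq_subRL ?(leq_trans _ le_i) // mulSn ?leq_add2r // ; lia.
(* After [d.+1] blocks of length [N] the bound is [d - (d + 1) = -1]. *)
exists (d.+1 * N)%N => i /main; apply: mxleW.
by rewrite -[d.+1]addn1 PoszD opprD addrA subrr sub0r.
Qed.

End Descent.

(** * The automaton *)

(** As [2^-m] tends to [0], a distance at least [eps] forces a difference within a fixed window.
    With [window_cdist_ge], this replaces the metric by windows. *)
Lemma cdist_ge_window p n (eps : R) : Rlt R0 eps -> exists k : nat,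
  forall c c' : config p n, Rle eps (cdist c c') ->
  exists i : int, (`|i| <= k)%N /\ c i <> c' i.
Proof.
move=> eps0.
have [|k hk] := pow_lt_1_zero (Rinv (Rplus R1 R1)) _ eps eps0.
  by rewrite Rabs_right; lra.
exists k => c c'; rewrite /cdist.
case: (ClassicalDescription.excluded_middle_informative _) => [ex|_]; last first.
  by move=> h; lra.
case: ex_minnP => m dm _ le_eps.
have le_mk : (m <= k)%N.
  rewrite leqNgt; apply/negP => /ltnW/ssrnat.leP lt_km; have := hk m lt_km.
  rewrite pow_inv Rabs_right; first by lra.
  by apply: Rle_ge; apply: Rlt_le; apply: Rinv_0_lt_compat; apply: pow_lt; lra.
by case/orP: dm => /eqP ne; [exists m%:Z | exists (- m%:Z)]; rewrite ?abszN.
Qed.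

Lemma window_cdist_ge p n (k : nat) (c c' : config p n) (i : int) :
  (`|i| <= k)%N -> c i <> c' i -> Rle (Rinv (pow (Rplus R1 R1) k)) (cdist c c').
Proof.
move=> le_ik ne_i.
have di : diff_at c c' `|i|%N.
  rewrite /diff_at; have [i0|i0] := leP 0 i.
    by rewrite gez0_abs //; apply/orP; left; apply/eqP.
  by rewrite (ltz0_abs i0) opprK; apply/orP; right; apply/eqP.
rewrite /cdist.
case: (ClassicalDescription.excluded_middle_informative _) => [ex|]; last first.
  by case; exists `|i|%N.
case: ex_minnP => m _ /(_ _ di) le_mi.
apply: Rinv_le_contravar; first by apply: pow_lt; lra.
apply: Rle_pow; first lra.
by apply/ssrnat.leP; apply: leq_trans le_ik.
Qed.

Section Automaton.
Variables (p n r : nat) (Am : int -> 'M['F_p]_n.+1).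
Local Notation K := 'F_p.
Local Notation F := (lca r Am).
Implicit Types (c : config p n.+1).

(* [X^r] times the matrix associated with the automaton. *)
Definition poly_mx : 'M[{poly K}]_n.+1 :=
  \sum_(k < (2 * r).+1) 'X^(2 * r - k) *: map_mx polyC (Am (k%:Z - r%:Z)).

Local Notation P := poly_mx.

(** The factor [X^r] that clears the denominators of the associated matrix is undone by reading at
    [i + r]. *)
Lemma lca_mact c i : F c i = mact P c (i + r%:Z).
Proof.
rewrite /lca mact_sum; apply: eq_bigr => k _; apply/colP => a.
rewrite mactZ -[X in pact X]mul1r pactMXn pactC mul1r mactE mxE.
apply: eq_bigr => b _; rewrite mxE pactC; congr (_ * c _ b 0).
by have := ltn_ord k; lia.
Qed.

Lemma iter_lca l c i : iter l F c i = mact (P ^+ l) c (i + (l * r)%N%:Z).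
Proof.
elim: l i => [|l IH] i; first by rewrite addr0 mact1.
rewrite iterS lca_mact exprS mactM.
rewrite (eq_mact (c' := fun j => mact (P ^+ l) c (j + (l * r)%N%:Z)) _ _ IH).
by rewrite mact_shift mulSn PoszD addrA.
Qed.

Lemma iter_lcaB l c c' i :
  iter l F (fun j => c j - c' j) i = iter l F c i - iter l F c' i.
Proof. by rewrite !iter_lca mactB. Qed.

Definition window_injective (k : nat) := forall c,
  (forall l i, (`|i| <= k)%N -> iter l F c i = 0) -> forall i, c i = 0.

(** By linearity, separating [c] from [c'] amounts to separating [c - c'] from the zero
    configuration. *)
Lemma pos_expansiveP : pos_expansive F <-> exists k, window_injective k.
Proof.
split=> [[eps [eps0 hF]]|[k hk]].
  have [k hk] := cdist_ge_window p n.+1 eps0; exists k => c c0.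
  pose z : config p n.+1 := fun=> 0.
  have z0 l i : iter l F z i = 0.
    have := iter_lcaB l z z i; rewrite subrr => <-.
    by congr (iter l F _ i); apply: functional_extensionality => j; rewrite subrr.
  have [-> //|ne_cz] := classic (c = z).
  have [l /hk[i [le_ik]]] := hF _ _ ne_cz.
  by rewrite c0 // z0.
exists (Rinv (pow (Rplus R1 R1) k)); split.
  by apply: Rinv_0_lt_compat; apply: pow_lt; lra.
move=> c c' ne_cc'; apply: NNPP => no_l; apply: ne_cc'.
apply: functional_extensionality => i; apply/eqP; rewrite -subr_eq0; apply/eqP.
apply: (hk (fun j => c j - c' j)) => l j le_jk.
rewrite iter_lcaB; apply/eqP; rewrite subr_eq0; apply/eqP; apply: NNPP => ne_j.
by apply: no_l; exists l; apply: window_cdist_ge ne_j.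
Qed.

(** Continuity of the action, needed to pass to a limit configuration. *)
Lemma mact_local (M : 'M[{poly K}]_n.+1) s : exists m : nat,
  forall c c', (forall j : int, (`|j| < m)%N -> c j = c' j) ->
  mact M c s = mact M c' s.
Proof.
exists (`|s| + \max_ab size (M ab.1 ab.2)).+1%N => c c' cc'.
apply/colP => a; rewrite !mactE; apply: eq_bigr => b _; apply: eq_bigr => i _.
have tri (x : nat) : (`|s - x%:Z| <= `|s| + x)%N by lia.
rewrite cc' // ltnS; apply: leq_trans (tri i) _; rewrite leq_add2l.
apply: leq_trans (ltnW (ltn_ord i)) _.
exact: (leq_bigmax (F := fun ab : 'I_n.+1 * 'I_n.+1 => size (M ab.1 ab.2)) (a, b)).
Qed.

(** Otherwise, counterexamples [cs N] for all [N] have a limit point whose whole orbit vanishes on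
    the window. It is zero, yet it agrees with some [cs N] at the sites [k.+1] and [- k.+1]. *)
Lemma window_compactness k : window_injective k -> exists N, forall c,
  (forall l i, (l <= N)%N -> (`|i| <= k)%N -> iter l F c i = 0) ->
  c k.+1%:Z = 0 /\ c (- k.+1%:Z) = 0.
Proof.
move=> hk; apply: NNPP => noN.
have bad N : exists c, (forall l i, (l <= N)%N -> (`|i| <= k)%N -> iter l F c i = 0)
    /\ ~ (c k.+1%:Z = 0 /\ c (- k.+1%:Z) = 0).
  apply: NNPP => nc; apply: noN; exists N => c hc; apply: NNPP => ne.
  by apply: nc; exists c.
pose cs N := proj1_sig (constructive_indefinite_description _ (bad N)).
have csP N : (forall l i, (l <= N)%N -> (`|i| <= k)%N -> iter l F (cs N) i = 0)
    /\ ~ (cs N k.+1%:Z = 0 /\ cs N (- k.+1%:Z) = 0).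
  by rewrite /cs; case: constructive_indefinite_description.
(* Pairing the sites [j] and [- j] folds a bi-infinite configuration into a sequence indexed by
   [nat]. *)
have [g hg] := koenig (fun N j => (cs N j%:Z, cs N (- j%:Z))).
pose c : config p n.+1 := fun i => if 0 <= i then (g `|i|%N).1 else (g `|i|%N).2.
have agree m N0 : exists2 N, (N0 <= N)%N &
    forall i : int, (`|i| < m)%N -> cs N i = c i.
  have [N leN hN] := hg m N0; exists N => // i /hN; rewrite /c => <- /=.
  by case: leP => i0; [rewrite gez0_abs | rewrite ltz0_abs // opprK].
have c0 : forall i, c i = 0.
  apply: hk => l i le_ik.
  have [m hm] := mact_local (P ^+ l) (i + (l * r)%N%:Z).
  have [N leN hN] := agree m l.
  rewrite iter_lca -(hm (cs N) c hN) -iter_lca.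
  by apply: (csP N).1.
have [N _ hN] := agree k.+2 0%N; apply: (csP N).2.
by rewrite !hN ?abszN // !c0.
Qed.

Local Notation tofmx := (map_mx (@FracField.tofrac {poly K})).
Local Notation A := (assoc_mx r Am).

Lemma Xl_neq0 : Xl p != 0.
Proof. by rewrite /Xl tofrac_eq0 polyX_eq0. Qed.

Lemma poly_mxE : tofmx P = Xl p ^+ r *: A.
Proof.
rewrite /assoc_mx scaler_sumr raddf_sum; apply: eq_bigr => k _ /=.
rewrite scalerA [Xl p ^+ r]exprnP -expfzDr ?Xl_neq0 //.
have -> : r%:Z + - (k%:Z - r%:Z) = (2 * r - k)%N%:Z by have := ltn_ord k; lia.
apply/matrixP => a b; rewrite !mxE tofracM; congr (_ * _).
by rewrite -exprnP /Xl tofracXn.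
Qed.

Lemma poly_mxX l : tofmx (P ^+ l) = Xl p ^+ (l * r) *: A ^+ l.
Proof.
rewrite (rmorphXn (map_mx (@FracField.tofrac {poly K}))) /= poly_mxE.
by rewrite exprZn -exprM mulnC.
Qed.

Lemma nu_Xl b : nu b (Xl p) = dirz b.
Proof. by rewrite /Xl nu_tofrac ?polyX_eq0 // pdegX. Qed.

(** After clearing denominators, the coefficients of [v] form a configuration. A window placed just
    beyond its degree bound stays zero up to time [N], so the site at the bound is zero as well. *)
Lemma window_expanding k : window_injective k -> exists N,
  forall b (v : 'cV[Lfrac p]_n.+1) d,
  (forall l, (l <= N)%N -> mxle (nu b) (A ^+ l *m v) d) -> mxle (nu b) v (d - 1).
Proof.
move=> /window_compactness[N hN]; exists N => b v d hv.
have [q [w [q0 Ew]]] := frac_common_denom v.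
have q0F : q%:F != 0 :> Lfrac p by rewrite tofrac_eq0.
have nuP : valuation (nu (K := K) b) by exact: nu_valuation.
pose d' := d + nu b q%:F.
have hw l : (l <= N)%N -> forall a s, d' + dirz b * (l * r)%N%:Z < dirz b * s ->
    icoef ((P ^+ l *m w) a 0) s = 0.
  move=> lN a; apply/vle_tofrac.
  have -> : ((P ^+ l *m w) a 0)%:F = (A ^+ l *m v) a 0 * (q%:F * Xl p ^+ (l * r)).
    have -> : ((P ^+ l *m w) a 0)%:F = tofmx (P ^+ l *m w) a 0 by rewrite [RHS]mxE.
    rewrite map_mxM Ew poly_mxX -scalemxAl -scalemxAr scalerA [LHS]mxE.
    by rewrite [LHS]mulrC [q%:F * _]mulrC.
  have X0 : Xl p ^+ (l * r) != 0 := expf_neq0 _ Xl_neq0.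
  rewrite /d' -addrA; apply: (vleM nuP); first exact: hv.
  have -> : dirz b * (l * r)%N%:Z = nu b (Xl p ^+ (l * r)).
    by rewrite (nuX nuP _ Xl_neq0) nu_Xl -mulr_natr natz.
  by rewrite -(nuM nuP q0F X0) nu_vle.
(* The site [- dirz b * k.+1], adjacent to the window, then carries the exponent [dirz b * d'], and
   the window carries exponents beyond it. *)
pose t := dirz b * (d' + k.+1%:Z).
have hc : vcoef w (dirz b * d') = 0.
  have [] := hN (fun i => vcoef w (i + t)).
    move=> l i lN le_ik; rewrite iter_lca mact_shift -vcoefM.
    apply/colP => a; rewrite [LHS]mxE [RHS]mxE; apply: (hw l lN).
    by rewrite /t /dirz; case: (b); lia.
  rewrite /t /dirz; case: (b) => h1 h2.
    by rewrite -[RHS]h2; congr (vcoef w _); lia.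
  by rewrite -[RHS]h1; congr (vcoef w _); lia.
move=> a j; rewrite ord1.
rewrite -(vleM_eq nuP _ _ q0F).
have -> : v a 0 * q%:F = (w a 0)%:F.
  by move/colP/(_ a): Ew; rewrite !mxE mulrC => ->.
apply/vle_tofrac => s hs.
have [Es|ne_s] := eqVneq (dirz b * s) d'.
  have -> : s = dirz b * d' by rewrite -Es dirzK.
  by move/colP/(_ a): hc; rewrite !mxE.
have := hw 0%N (leq0n _) a s; rewrite expr0 mul1mx; apply.
rewrite mul0n mulr0 addr0 lt_neqAle eq_sym ne_s /=.
by move: hs; rewrite addrAC ltrBlDr ltzD1.
Qed.

End Automaton.


(** * The criterion *)

(** Substituting [x *: 'X] in [char_poly (x *: M)] factors [x] out of each row of the determinant.
    The form without division allows any [x]. *)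
Lemma coef_char_polyZ (R : comNzRingType) m (x : R) (M : 'M[R]_m) i :
  x ^+ i * (char_poly (x *: M))`_i = x ^+ m * (char_poly M)`_i.
Proof.
have E : char_poly (x *: M) \Po (x *: 'X) = (x ^+ m)%:P * char_poly M.
  rewrite /char_poly -det_map_mx rmorphXn /= -detZ; congr (\det _).
  apply/matrixP => a b; rewrite !mxE rmorphB /= rmorphMn /= comp_polyX comp_polyC.
  by rewrite mulrBr mulrnAr mul_polyC polyCM.
have := congr1 (fun f : {poly R} => f`_i) E; rewrite coefCM => <- {E}.
move: (char_poly (x *: M)) => f; rewrite comp_polyE coef_sum.
under eq_bigr => j _ do
  rewrite coefZ -mul_polyC exprMn -rmorphXn coefCM coefXn.
have [lt_if|le_fi] := ltnP i (size f).
  rewrite (bigD1 (Ordinal lt_if)) //= eqxx mulr1 mulrC big1 ?addr0 // => j.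
  by rewrite -val_eqE /= eq_sym => /negPf ->; rewrite !mulr0.
rewrite nth_default // mulr0 big1 // => j _.
by rewrite gtn_eqF ?mulr0 // (leq_trans (ltn_ord j)).
Qed.

Section LaurentDegree.
Variables (p : nat) (x : Lfrac p) (k : nat) (q : {poly 'F_p}).
Hypotheses (x0 : x != 0) (xq : x * Xl p ^+ k = q%:F).

(** [lrep] is an arbitrary choice, valid as soon as one representation exists; the valuation of [x]
    does not depend on it. *)
Let lrepP : x * Xl p ^+ (lrep x).1 = ((lrep x).2)%:F.
Proof.
apply: (epsilon_spec (inhabits (0%N, 0))
  (fun kq : nat * {poly 'F_p} => x * Xl p ^+ kq.1 = (kq.2)%:F)).
by exists (k, q).
Qed.

Let nu_lrep b : nu b x = pdeg b (lrep x).2 - dirz b * (lrep x).1%:Z.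
Proof.
have nuP : valuation (nu (K := 'F_p) b) by exact: nu_valuation.
have X0 := expf_neq0 (lrep x).1 (Xl_neq0 p).
have : nu b (x * Xl p ^+ (lrep x).1) = pdeg b (lrep x).2.
  rewrite lrepP nu_tofrac //; apply: contraTneq (mulf_neq0 x0 X0) => q0.
  by rewrite lrepP q0 tofrac0 eqxx.
rewrite (nuM nuP x0 X0) (nuX nuP _ (Xl_neq0 p)) nu_Xl -mulr_natr natz => <-.
by rewrite addrK.
Qed.

Lemma deg_plusE : deg_plus x = Some (nu true x).
Proof. by rewrite /deg_plus (negPf x0) nu_lrep /pdeg /dirz mul1r. Qed.

Lemma deg_minusE : deg_minus x = Some (- nu false x).
Proof.
rewrite /deg_minus (negPf x0) nu_lrep /pdeg /dirz; congr Some.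
by rewrite mulN1r !opprD !opprK.
Qed.

End LaurentDegree.

Section Criterion.
Variables (p n r : nat) (Am : int -> 'M['F_p]_n.+1).
Local Notation K := 'F_p.
Local Notation F := (lca r Am).
Local Notation A := (assoc_mx r Am).
Local Notation P := (poly_mx r Am).
Implicit Types (c : config p n.+1).

(** Shows that the coefficients of [char_poly A] are Laurent polynomials, as [deg_plusE] and
    [deg_minusE] require. *)
Lemma coef_char_poly_mx i : (i <= n.+1)%N ->
  (char_poly A)`_i * Xl p ^+ (r * (n.+1 - i)) = ((char_poly P)`_i)%:F.
Proof.
move=> le_in; have -> : ((char_poly P)`_i)%:F = (char_poly (Xl p ^+ r *: A))`_i.
  by rewrite -poly_mxE -map_char_poly coef_map.
have X0 := expf_neq0 (r * i) (Xl_neq0 p).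
apply: (mulfI X0); rewrite mulrCA -exprD -mulnDr subnKC //.
by rewrite !exprM coef_char_polyZ mulrC.
Qed.

(* The indices above the degree are harmless since [vle] holds at [0]; the index
   [n.+1] of the leading coefficient encodes [0 < nu b (char_poly A)`_0]. *)
Definition dominated := (char_poly A)`_0 != 0 /\
  forall b i, (0 < i)%N ->
    vle (nu b) (char_poly A)`_i (nu b (char_poly A)`_0 - 1).

Lemma mx_expansiveP : mx_expansive A <-> dominated.
Proof.
have sz : size (char_poly A) = n.+2 by rewrite size_char_poly.
have degp i : (i <= n.+1)%N -> (char_poly A)`_i != 0 ->
    deg_plus (char_poly A)`_i = Some (nu true (char_poly A)`_i) /\
    deg_minus (char_poly A)`_i = Some (- nu false (char_poly A)`_i).
  move=> le_in a0; have E := coef_char_poly_mx le_in.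
  by rewrite (deg_plusE a0 E) (deg_minusE a0 E).
have lead : (char_poly A)`_n.+1 = 1.
  by have /monicP := char_poly_monic A; rewrite /lead_coef sz.
rewrite /mx_expansive /expansive_poly sz /=; split.
  case=> _ a0 [+ hp] [+ hm]; have [Ep Em] := degp 0%N isT a0.
  rewrite Ep Em in hp hm *; rewrite /= => p0 m0; split=> // b i i_gt0.
  have [->|ai0] := eqVneq (char_poly A)`_i 0; first exact: vle0.
  have [lt_in|] := ltnP i n.+1.
    have [Eip Eim] := degp i (ltnW lt_in) ai0.
    have := hp i; have := hm i; rewrite i_gt0 lt_in Eip Eim /= => /(_ isT) h1 /(_ isT) h2.
    by rewrite vle_neq0 //; case: (b); lia.
  rewrite leq_eqVlt => /orP[/eqP <-|lt_ni]; last first.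
    by rewrite nth_default ?sz // eqxx in ai0.
  rewrite lead vle_neq0 ?oner_eq0 // nu1; last exact: nu_valuation.
  by rewrite lerBrDr lezD1; case: (b) => //; rewrite -oppr_lt0.
case=> a0 ha; have [Ep Em] := degp 0%N isT a0; rewrite Ep Em /=.
have h1 b : 0 < nu b (char_poly A)`_0.
  have := ha b n.+1 isT; rewrite lead vle_neq0 ?oner_eq0 // nu1; first by rewrite lerBrDr lezD1.
  exact: nu_valuation.
have hi b i : (0 < i < n.+1)%N -> (char_poly A)`_i != 0 ->
    nu b (char_poly A)`_i < nu b (char_poly A)`_0.
  by case/andP=> i0 _ ai0; have := ha b i i0; rewrite vle_neq0 // lerBrDr lezD1.
split=> //; first exact: char_poly_monic.
  split=> // i hin; have [ai0|ai0] := eqVneq (char_poly A)`_i 0.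
    by rewrite /deg_plus ai0 eqxx.
  have /andP[_ /ltnW lt_in] := hin.
  by rewrite (degp i lt_in ai0).1 /=; apply: hi.
split; first by rewrite oppr_lt0.
move=> i hin; have [ai0|ai0] := eqVneq (char_poly A)`_i 0.
  by rewrite /deg_minus ai0 eqxx.
have /andP[_ /ltnW lt_in] := hin.
by rewrite (degp i lt_in ai0).2 /= ltrN2; apply: hi.
Qed.

Lemma pos_expansive_dominated : prime p -> pos_expansive F -> dominated.
Proof.
move=> p_pr /pos_expansiveP[k /window_expanding[N hN]].
have nuP b : valuation (nu (K := K) b) by exact: nu_valuation.
have dA : \det A != 0 := expanding_det_neq0 (hN true).
have chp : p \in [pchar Lfrac p].
  apply: (rmorph_pchar (@FracField.tofrac {poly K})).
  by rewrite pchar_poly pchar_Fp.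
have key b : (char_poly A)`_0 != 0 /\ forall i, (0 < i)%N ->
    vle (nu b) (char_poly A)`_i (nu b (char_poly A)`_0 - 1).
  have [m hm] := expanding_inverse_powers (hN b).
  apply: (char_poly_coef_lt (k := m) (nuP b) chp dA).
  (* Since [m < p ^ m], the exponent [p ^ m] is past the threshold [m]. *)
  by apply: hm; apply: ltnW; apply: ltn_expl; apply: prime_gt1.
by split=> [|b i i0]; [case: (key true) | apply: (key b).2].
Qed.

(** The Cayley-Hamilton identity of [P], multiplied by [P ^+ l] and applied to [c]; the shift by
    [(i + l) * r] comes from [iter_lca]. *)
Lemma cayley_hamilton_lca l c s a :
  \sum_(i < n.+2) pact (char_poly P)`_i
    (fun j => iter (i + l) F c (j - ((i + l) * r)%N%:Z) a 0) s = 0.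
Proof.
have CH : \sum_(i < n.+2) (char_poly P)`_i *: (P ^+ (i + l)) = 0.
  have hE (f : {poly {poly K}}) :
      horner_mx P f = \sum_(i < size f) f`_i *: (P ^+ i).
    rewrite -{1}[f]coefK poly_def rmorph_sum; apply: eq_bigr => i _ /=.
    by rewrite horner_mxZ rmorphXn /= horner_mx_X.
  have := hE (char_poly P); rewrite Cayley_Hamilton size_char_poly => H.
  rewrite -[RHS](mul0r (P ^+ l)) [X in _ = X * _]H mulr_suml; apply: eq_bigr => i _.
  by rewrite -scalerAl exprD.
have := congr1 (fun M => mact M c s a 0) CH.
rewrite mact_sum mact0l summxE [RHS]mxE => H; rewrite -[RHS]H; apply: eq_bigr => i _.
rewrite mactZ; apply: eq_pact => j; by rewrite iter_lca subrK.
Qed.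

(* Cayley-Hamilton read at the extreme monomial of the constant coefficient:
   the value at any site and time is a combination of values, at later times,
   of sites lying strictly further in the direction [b] and at bounded
   distance. *)
Lemma dominated_one_sided b : dominated -> exists k0, forall k c, (k0 <= k)%N ->
  (forall l i, (`|i| <= k)%N -> iter l F c i = 0) ->
  forall l i, dirz b * i <= k%:Z -> iter l F c i = 0.
Proof.
case=> a0 ha; have nuP : valuation (nu (K := K) b) by exact: nu_valuation.
pose D := nu b (char_poly A)`_0; pose q i := (char_poly P)`_i.
(* The extreme exponent of [q 0]: that of the constant coefficient of [char_poly A], moved by the
   factor [X^(r * n.+1)]. *)
pose e0 := dirz b * D + (r * n.+1)%N%:Z.
have nuXn j : nu b (Xl p ^+ j) = dirz b * j%:Z.
  by rewrite (nuX nuP _ (Xl_neq0 p)) nu_Xl -mulr_natr natz.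
have q0E : (q 0%N)%:F = (char_poly A)`_0 * Xl p ^+ (r * n.+1).
  by rewrite -coef_char_poly_mx // subn0.
have q00 : q 0%N != 0.
  rewrite -tofrac_eq0 q0E; apply: mulf_neq0 a0 _; exact: expf_neq0 _ (Xl_neq0 p).
have pq0 : pdeg b (q 0%N) = dirz b * e0.
  rewrite -nu_tofrac // q0E (nuM nuP a0 (expf_neq0 _ (Xl_neq0 p))) nuXn.
  by rewrite /e0 mulrDr dirzK.
have top0 : icoef (q 0%N) e0 != 0.
  by have := icoef_pdeg b q00; rewrite pq0 dirzK.
have low0 e : dirz b * e0 < dirz b * e -> icoef (q 0%N) e = 0.
  by rewrite -pq0; apply: icoef_gt_pdeg.
(* The monomial [e] of [q i] reads a site displaced by [e + i * r]; domination kills those displaced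
   as far as [e0] or beyond. *)
have lowi i e : (0 < i <= n.+1)%N -> dirz b * e0 <= dirz b * (e + (i * r)%N%:Z) ->
    icoef (q i) e = 0.
  case/andP=> i_gt0 le_in he.
  have : vle (nu b) (q i)%:F (D - 1 + dirz b * (r * (n.+1 - i))%N%:Z).
    rewrite -coef_char_poly_mx //; apply: (vleM nuP); first exact: ha.
    by rewrite -nuXn; exact: nu_vle.
  move/vle_tofrac; apply; apply: lt_le_trans (_ : D + dirz b * (r * (n.+1 - i))%N%:Z <= _).
    by rewrite ltrD2r ltrBlDr ltzD1.
  have Er : (r * (n.+1 - i))%N%:Z = (r * n.+1)%N%:Z - (i * r)%N%:Z.
    by rewrite mulnBr [(i * r)%N]mulnC -subzn // leq_mul2l le_in orbT.
  move: he; rewrite Er /e0; generalize D => D1.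
  by rewrite !mulrDr dirzK mulrN addrA lerBlDr.
pose S := (\max_(i < n.+2) size (q i))%N.
(* Bounds the distance from [x] to any site read: exponents are below [S] and the displacements
   [i * r] at most [n.+1 * r]. *)
exists (`|e0| + S + n.+1 * r)%N => k c le_k c0 l i.
(* The zero region starts as the window and grows by one site at a time, opposite to the direction
   [b]. *)
suff main (t : nat) : forall l x, - k%:Z - t%:Z <= dirz b * x <= k%:Z -> iter l F c x = 0.
  move=> hi; apply: (main `|i|%N); rewrite hi andbT.
  by rewrite /dirz; case: (b); lia.
elim: t => [|t IH] {i}{}l x hx.
  by apply: c0; move: hx; rewrite /dirz; case: (b); lia.
have [hx'|hx'] := boolP (- k%:Z - t%:Z <= dirz b * x <= k%:Z); first exact: IH.
have Ex : dirz b * x = - k%:Z - t%:Z - 1 by move: hx hx'; lia.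
have near y : dirz b * x < dirz b * y -> (`|x - y| <= k)%N -> forall l, iter l F c y = 0.
  move=> lt_xy le_xy l'; apply: IH; move: Ex lt_xy le_xy.
  by rewrite /dirz; case: (b); lia.
apply/colP => a; rewrite [RHS]mxE.
(* At this position the monomial [e0] of [q 0] reads exactly the site [x] at time [l]. *)
have := cayley_hamilton_lca l c (x + e0 + (l * r)%N%:Z) a.
rewrite big_ord_recl big1 ?addr0 => [|i _]; last first.
  rewrite lift0; apply: big1 => e _.
  (* Either the coefficient vanishes or the site read lies strictly beyond [x] in the direction [b],
     where the orbit is already zero. *)
  have [he|he] := leP (dirz b * e0) (dirz b * (e%:Z + (i.+1 * r)%N%:Z)).
    by have /= -> := @lowi i.+1 e%:Z (ltn_ord i) he; rewrite mul0r.
  rewrite near ?mxE ?mulr0 //.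
    move: he; rewrite mulnDl PoszD; move: (i.+1 * r)%N (l * r)%N => u v.
    by rewrite /dirz; case: (b); lia.
  have le_ir : (i.+1 * r <= n.+1 * r)%N by rewrite leq_mul2r ltn_ord orbT.
  have lt_eS : (e < S)%N.
    apply: leq_trans (ltn_ord e) _.
    exact: (leq_bigmax (F := fun j : 'I_n.+2 => size (q j)) (lift ord0 i)).
  move: le_k le_ir lt_eS; rewrite mulnDl PoszD.
  move: (i.+1 * r)%N (l * r)%N (n.+1 * r)%N (e : nat) S => u v w f S'.
  by move: hx; lia.
rewrite /= /pact -/(q 0%N).
have := top0; case Ee: e0 => [m0|m0] /=; last by rewrite ?eqxx.
move=> qm0; have lt_m0 : (m0 < size (q 0%N))%N.
  by rewrite ltnNge; apply/negP => le_qm; rewrite nth_default ?eqxx in qm0.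
rewrite (bigD1 (Ordinal lt_m0)) //= big1 ?addr0 => [|e ne_e]; last first.
  have ne_em : (e : nat) != m0 by rewrite -val_eqE in ne_e.
  have [he|he] := ltP (dirz b * e0) (dirz b * e%:Z).
    by have /= -> := low0 e%:Z he; rewrite mul0r.
  rewrite near ?mxE ?mulr0 //.
    move: he ne_em; rewrite Ee add0n; move: (l * r)%N (nat_of_ord e) => v f.
    rewrite /dirz neq_ltn => + /orP[]; case: (b); rewrite ?mul1r ?mulN1r; lia.
  have lt_eS : (e < S)%N.
    apply: leq_trans (ltn_ord e) _.
    exact: (leq_bigmax (F := fun j : 'I_n.+2 => size (q j)) ord0).
  move: le_k lt_eS; rewrite Ee add0n; move: (l * r)%N (n.+1 * r)%N (e : nat) S => v w f S'.
  by lia.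
move/eqP; rewrite mulf_eq0 (negPf qm0) /= add0n => /eqP <-.
by congr (iter l F c _ a 0); move: (l * r)%N => v; lia.
Qed.

(** The half-lines obtained for the two directions cover all sites; [k1 + k2] is wide enough for
    both. *)
Lemma dominated_pos_expansive : dominated -> pos_expansive F.
Proof.
move=> dom; have [k1 h1] := dominated_one_sided true dom.
have [k2 h2] := dominated_one_sided false dom.
apply/pos_expansiveP; exists (k1 + k2)%N => c c0 i.
have := h1 _ c (leq_addr k2 k1) c0 0%N i.
have := h2 _ c (leq_addl k1 k2) c0 0%N i; rewrite /dirz mul1r mulN1r /= => H1 H2.
by have [le_i|lt_i] := leP i (k1 + k2)%N%:Z; [apply: H2 | apply: H1; lia].
Qed.

End Criterion.

Theorem theorem1 (p n r : nat) (Am : int -> 'M['F_p]_n) :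
  prime p -> (1 < n)%N ->
  (pos_expansive (lca r Am) <-> mx_expansive (assoc_mx r Am)).
Proof.
case: n Am => [//|n] Am p_pr _; rewrite mx_expansiveP; split.
  exact: pos_expansive_dominated.
exact: dominated_pos_expansive.
Qed.
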